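(* Let $C$ be a proper cone in $\mathbb{R}^n$, and let $A_1,\dots,A_m\in\mathcal{L}(\mathbb{R}^n)$ be quasi-monotone (QM) for $C$. If $A_1,\dots,A_m$ have a common linear Lyapunov function on $C$, then for every family $\{D_{ij}\}\in\mathcal{D}_m$ the zero steady state of the coupled linear system on $(\mathbb{R}^n)^m$ $$\dot x_i = A_i x_i+\sum_{j\neq i} D_{ij}(x_j-x_i),\qquad i=1,\dots,m,$$ is asymptotically stable with respect to all initial conditions in $(\mathbb{R}^n)^m$.
   Context: $\mathcal{L}(\mathbb{R}^n)$ is the set of linear maps from $\mathbb{R}^n$ to itself. A proper cone $C\subseteq\mathbb{R}^n$ is a non-empty, closed, convex subset that is a cone ($\alpha x\in C$ for all $\alpha\ge 0$, $x\in C$), solid (its interior is non-empty) and pointed (if $x\in C$ and $-x\in C$ then $x=0$). The dual cone is $C^*=\{\lambda\in(\mathbb{R}^n)^* : \lambda(x)\ge 0 \text{ for all } x\in C\}$, where $(\mathbb{R}^n)^*$ is the space of linear functionals on $\mathbb{R}^n$. $\partial C$ denotes the boundary of $C$. A linear map $A\in\mathcal{L}(\mathbb{R}^n)$ is quasi-monotone (QM) for $C$ if, whenever $(x,\lambda)\in\partial C\times C^*$ satisfies $\lambda(x)=0$, then $\lambda(Ax)\ge 0$. For $A_1,\dots,A_m$ that are QM for $C$, a functional $\lambda\in C^*$ is a common linear Lyapunov function for $A_1,\dots,A_m$ on $C$ if $\lambda(c)>0$ for all $c\in C\setminus\{0\}$, and $\lambda(A_ic)<0$ for all $c\in C\setminus\{0\}$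 and all $i=1,\dots,m$. A family $\{D_{ij}\}$ of linear maps $D_{ij}\in\mathcal{L}(\mathbb{R}^n)$, indexed by $i,j\in\{1,\dots,m\}$ with $i\ne j$ and satisfying $D_{ij}=D_{ji}$, acts diffusively on $C$ if for all $i\neq j$: (1) $D_{ij}(C)\subseteq C$; (2) whenever $(x,\lambda)\in\partial C\times C^*$ satisfies $\lambda(x)=0$, then $\lambda(D_{ij}x)=0$. $\mathcal{D}_m$ denotes the set of all such families $\{D_{ij}\}$ (with $D_{ij}=D_{ji}$) that act diffusively on $C$. *)

(* Defs.v *)
From HB Require Import structures.
From mathcomp Require Import all_boot all_order all_algebra.
From mathcomp Require Import all_classical all_reals all_analysis.

Set Implicit Arguments.
Unset Strict Implicit.
Unset Printing Implicit Defensive.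

Import Order.TTheory GRing.Theory Num.Theory numFieldNormedType.Exports.

Local Open Scope classical_set_scope.
Local Open Scope ring_scope.

Section Cones.
Context {R : realType} {n : nat}.
Implicit Types (C : set 'rV[R]_n).

Definition proper_cone C : Prop :=
  [/\ C !=set0,
      closed C,
      convex_set (C : set (convex_lmodType 'rV[R]_n)) &
      [/\ forall (a : R) (x : 'rV[R]_n), 0 <= a -> C x -> C (a *: x),
          interior C !=set0 &
          forall x, C x -> C (- x) -> x = 0]].

Definition dual_cone C : set {scalar 'rV[R]_n} :=
  [set lambda | forall x, C x -> 0 <= lambda x].

Definition boundary C : set 'rV[R]_n := closure C `\` interior C.

Definition quasi_monotone C (A : {linear 'rV[R]_n -> 'rV[R]_n}) : Prop :=
  forall (x : 'rV[R]_n) (lambda : {scalar 'rV[R]_n}),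
    boundary C x -> dual_cone C lambda -> lambda x = 0 -> 0 <= lambda (A x).

Definition common_linear_lyapunov C (m : nat)
    (A : 'I_m -> {linear 'rV[R]_n -> 'rV[R]_n})
    (lambda : {scalar 'rV[R]_n}) : Prop :=
  [/\ dual_cone C lambda,
      forall c, C c -> c != 0 -> 0 < lambda c &
      forall c, C c -> c != 0 -> forall i, lambda (A i c) < 0].

(* The set of families indexed by ordered pairs i != j; a total function
   'I_m -> 'I_m -> _ is used, and its diagonal values are never constrained
   nor used. *)
Definition diffusive_family C (m : nat)
    (D : 'I_m -> 'I_m -> {linear 'rV[R]_n -> 'rV[R]_n}) : Prop :=
  forall i j : 'I_m, i != j ->
    [/\ D i j =1 D j i,
        forall x, C x -> C (D i j x) &
        forall (x : 'rV[R]_n) (lambda : {scalar 'rV[R]_n}),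
          boundary C x -> dual_cone C lambda -> lambda x = 0 ->
          lambda (D i j x) = 0].

End Cones.

Section Stability.
Context {R : realType} {V : normedModType R}.

Definition solution (f : V -> V) (x : R -> V) : Prop :=
  {within `[0, +oo[, continuous x} /\
  forall t : R, 0 < t -> is_derive t 1 x (f (x t)).

(* Besides Lyapunov stability and attractivity, forward solutions are required
   to exist from every initial condition in S, so that the clauses quantifying
   over global solutions are not vacuous. *)
Definition asymptotically_stable (f : V -> V) (xs : V) (S : set V) : Prop :=
  [/\ f xs = 0,
      forall x0, S x0 -> exists x, solution f x /\ x 0 = x0,
      forall e : R, 0 < e -> exists2 d : R, 0 < d &
        forall x, solution f x -> S (x 0) -> `|x 0 - xs| < d ->
          forall t, 0 <= t -> `|x t - xs| < e &
      forall x, solution f x -> S (x 0) -> x t @[t --> +oo] --> xs].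

End Stability.

(* A state (x_1, ..., x_m) of (R^n)^m is the m x n matrix whose i-th row is
   x_i. *)
Definition coupled_field {R : realType} {n m : nat}
    (A : 'I_m -> {linear 'rV[R]_n -> 'rV[R]_n})
    (D : 'I_m -> 'I_m -> {linear 'rV[R]_n -> 'rV[R]_n})
    (X : 'M[R]_(m, n)) : 'M[R]_(m, n) :=
  \matrix_(i < m)
    (A i (row i X) + \sum_(j < m | j != i) D i j (row j X - row i X)).

(* Main.v *)
Require Import Defs.
From HB Require Import structures.
From mathcomp Require Import all_boot all_order all_algebra.
From mathcomp Require Import all_classical all_reals all_analysis.
From mathcomp Require Import ring lra.

Set Implicit Arguments.
Unset Strict Implicit.
Unset Printing Implicit Defensive.

Import Order.TTheory GRing.Theory Num.Theory numFieldNormedType.Exports.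

Local Open Scope classical_set_scope.
Local Open Scope ring_scope.

(* The coupled field is quasi-monotone for the cone C^m, because the terms
   D i j x_i are annihilated by every functional that vanishes at a boundary point
   x_i; hence C^m is forward invariant. The sum over i of lambda (x_i) is a linear
   Lyapunov function on C^m: the coupling terms cancel in pairs by the symmetry of
   D, and what is left decays exponentially by compactness of the unit sphere of C.
   An arbitrary solution x is squeezed between - s u and s u, where u is the
   solution starting at (e, ..., e) with e interior to C and s is proportional to
   the norm of x 0, so that x inherits the exponential decay of u. *)

(** * The entrywise inner product, continuity of linear maps, and separation from a closed cone *)

(** Row vectors stand for functionals through this pairing, so that the dual cone inherits the
    topology of ['rV[R]_n] and compactness arguments apply to it. *)
Definition mxdot {R : pzSemiRingType} {m n : nat} (W X : 'M[R]_(m, n)) : R :=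
  \sum_(p : 'I_m * 'I_n) W p.1 p.2 * X p.1 p.2.

Lemma mxdot_is_linear (R : comPzRingType) (m n : nat) (W : 'M[R]_(m, n)) :
  scalar (mxdot W).
Proof.
move=> a X Y; rewrite /mxdot mulr_sumr -big_split; apply: eq_bigr => p _ /=.
by rewrite !mxE mulrDr mulrCA.
Qed.

HB.instance Definition _ (R : comPzRingType) (m n : nat) (W : 'M[R]_(m, n)) :=
  GRing.isLinear.Build R 'M[R]_(m, n) R *%R (mxdot W) (mxdot_is_linear W).

Lemma mxdotC (R : comPzRingType) (m n : nat) (W X : 'M[R]_(m, n)) :
  mxdot W X = mxdot X W.
Proof. by apply: eq_bigr => p _; rewrite mulrC. Qed.

Lemma mxdot_sqrD (R : comPzRingType) (m n : nat) (X Y : 'M[R]_(m, n)) :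
  mxdot (X + Y) (X + Y) = mxdot X X + 2 * mxdot X Y + mxdot Y Y.
Proof.
rewrite linearD /= ![mxdot (X + Y) _]mxdotC !linearD /= (mxdotC Y X).
by rewrite mulr_natl mulr2n !addrA.
Qed.

Lemma mxdot_sqrZ (R : comPzRingType) (m n : nat) (a : R) (X : 'M[R]_(m, n)) :
  mxdot (a *: X) (a *: X) = a ^+ 2 * mxdot X X.
Proof. by rewrite linearZ /= mxdotC linearZ /= mulrA. Qed.

Lemma mxdot_ge0 (R : realDomainType) (m n : nat) (X : 'M[R]_(m, n)) :
  0 <= mxdot X X.
Proof. by apply: sumr_ge0 => p _; rewrite -expr2 sqr_ge0. Qed.

Lemma ler_mx_norm (R : realDomainType) (m n : nat) (X : 'M[R]_(m, n)) i j :
  `|X i j| <= `|X|.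
Proof.
rewrite [leRHS]/Num.Def.normr/= mx_normrE.
exact: (le_bigmax _ (fun p : 'I_m * 'I_n => `|X p.1 p.2|) (i, j)).
Qed.

Lemma mx_norm_le (R : realDomainType) (m n : nat) (X : 'M[R]_(m, n)) (a : R) :
  0 <= a -> (forall i j, `|X i j| <= a) -> `|X| <= a.
Proof.
move=> a0 Xa; rewrite [leLHS]/Num.Def.normr/= mx_normrE.
by apply/bigmax_leP; split => // p _; exact: Xa.
Qed.

Lemma mxdot_continuous (R : realFieldType) (m n : nat) (T : topologicalType)
    (F G : T -> 'M[R]_(m, n)) :
  continuous F -> continuous G -> continuous (fun x => mxdot (F x) (G x)).
Proof.
move=> cF cG x; rewrite /continuous_at /mxdot.
apply: cvg_big => [|p _]; [exact: add_continuous|apply: cvgM].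
  exact: (continuous_comp (cF x) (@coord_continuous _ _ _ p.1 p.2 _)).
exact: (continuous_comp (cG x) (@coord_continuous _ _ _ p.1 p.2 _)).
Qed.

Lemma mxdot_sqr_coord_le (R : realDomainType) (m n : nat) (X : 'M[R]_(m, n)) i j :
  X i j ^+ 2 <= mxdot X X.
Proof.
rewrite /mxdot (bigD1 (i, j)) //= -expr2 lerDl.
by apply: sumr_ge0 => p _; rewrite -expr2 sqr_ge0.
Qed.

Lemma linear_mx_continuous (R : realFieldType) (m n : nat) (W : normedModType R)
    (f : 'M[R]_(m, n) -> W) : linear f -> continuous f.
Proof.
move=> lf.
pose f' : {linear 'M[R]_(m, n) -> W} := HB.pack f (GRing.isLinear.Build _ _ _ _ f lf).
have -> : f = fun Y => \sum_(p : 'I_m * 'I_n) Y p.1 p.2 *: f (delta_mx p.1 p.2).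
  apply/funext => Y; rewrite {1}(matrix_sum_delta Y) pair_bigA -[f]/(f' : _ -> _).
  by rewrite linear_sum; apply: eq_bigr => p _; rewrite linearZ.
apply: continuous_big => [|p _]; first exact: add_continuous.
by move=> X; apply: continuousZr_tmp; exact: coord_continuous.
Qed.

Lemma linear_mx_bounded (R : realFieldType) (m n : nat) (W : normedModType R)
    (f : 'M[R]_(m, n) -> W) :
  linear f -> exists2 k : R, 0 < k & forall X, `|f X| <= k * `|X|.
Proof.
move=> lf.
pose f' : {linear 'M[R]_(m, n) -> W} := HB.pack f (GRing.isLinear.Build _ _ _ _ f lf).
have /linear_boundedP/pinfty_ex_gt0[k k0 fk] :=
  (linear_bounded_continuous f').2 (linear_mx_continuous lf).
by exists k.
Qed.

(* The separating vector is [p - y], with [p] the Euclidean nearest point to [y] in [C]. *)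
Lemma separation (R : realType) (n : nat) (C : set 'rV[R]_n) (y : 'rV[R]_n) :
  closed C -> C 0 -> (forall u v, C u -> C v -> C (u + v)) ->
  (forall (a : R) u, 0 <= a -> C u -> C (a *: u)) -> ~ C y ->
  exists2 w, forall c, C c -> 0 <= mxdot w c & mxdot w y < 0.
Proof.
move=> clC C0 CD CZ Cy.
pose q (v : 'rV[R]_n) := mxdot (v - y) (v - y).
have cB : continuous (fun v : 'rV[R]_n => v - y).
  move=> v; apply: (@continuousB _ _ _ id (cst y)); first exact: cvg_id.
  exact: cst_continuous.
have cq : continuous q by exact: mxdot_continuous.
(* Cutting down to the sublevel set of [q] at the value [q 0] makes the minimisation compact; a
   minimiser there is a minimiser over all of [C]. *)
pose A := C `&` [set v | q v <= q 0].
have A0 : A 0 by split => //=.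
have cA : compact A.
  apply: bounded_closed_compact; last first.
    apply: closedI => //.
    exact: (@closed_comp _ _ q [set r | r <= q 0] (in1W cq) (@closed_le R (q 0))).
  exists (q 0 + 1 + `|y|); split; first exact: num_real.
  move=> M hM v /= [_ /= qv]; apply: le_trans (ltW hM).
  rewrite -[v in `|v|](subrK y); apply: (le_trans (ler_normD _ _)).
  rewrite lerD2r.
  have q0 : 0 <= q 0 by exact: mxdot_ge0.
  apply: mx_norm_le; first by lra.
  move=> i j.
  have := mxdot_sqr_coord_le (v - y) i j; rewrite -/(q v) => h.
  rewrite ler_norml; set a := _ i j in h *.
  have h2 : a ^+ 2 <= q 0 by exact: le_trans qv.
  apply/andP; split; nra.
have [p pA pmin] := EVT_min_rV (ex_intro _ _ A0) cA (continuous_subspaceT cq).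
move: pA; rewrite inE => -[Cp /= qp].
have pmin' c : C c -> q p <= q c.
  move=> Cc; have [/ltW h|h] := ltP (q 0) (q c); first exact: le_trans h.
  by apply: pmin; rewrite inE.
have qpD v : q (p + v) = q p + 2 * mxdot (p - y) v + mxdot v v.
  by rewrite /q addrAC mxdot_sqrD.
have hpos c : C c -> 0 <= mxdot (p - y) c.
  move=> Cc; rewrite leNgt; apply/negP => h.
  have qc : 0 <= mxdot c c by exact: mxdot_ge0.
  set a := mxdot (p - y) c in h; set b := mxdot c c in qc.
  (* The increment of [q] along [c] is [2 t a + t^2 b]; for this [t] it equals [t (a - t)], which is
     negative. *)
  pose t := - a / (b + 1).
  have t0 : 0 < t by rewrite /t divr_gt0; lra.
  have := pmin' (p + t *: c) (CD _ _ Cp (CZ _ _ (ltW t0) Cc)).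
  rewrite qpD mxdot_sqrZ linearZ /= -/a -/b.
  have tb : t * (b + 1) = - a by rewrite /t; field; lra.
  nra.
(* Moving from [p] towards the apex stays in [C] as long as [t <= 1], which gives the opposite
   inequality. *)
have hp : mxdot (p - y) p = 0.
  apply/eqP; rewrite eq_le hpos // andbT leNgt; apply/negP => h.
  have qc : 0 <= mxdot p p by exact: mxdot_ge0.
  set a := mxdot (p - y) p in h; set b := mxdot p p in qc.
  pose t := a / (a + b + 1).
  have tb : t * (a + b + 1) = a by rewrite /t; field; lra.
  have t0 : 0 < t by rewrite /t divr_gt0; lra.
  have t1 : t <= 1 by nra.
  have Cpt : C (p + - t *: p).
    rewrite -[X in X + _]scale1r -scalerDl; apply: CZ => //; lra.
  have := pmin' _ Cpt.
  rewrite qpD mxdot_sqrZ [mxdot (p - y) (_ *: p)]linearZ /= -/a -/b; nra.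
exists (p - y) => //.
have : mxdot (p - y) (p - y) > 0.
  rewrite lt_neqAle eq_sym; apply/andP; split; last first.
    exact: mxdot_ge0.
  apply/eqP => h0; apply: Cy; suff -> : y = p by [].
  apply/esym/subr0_eq/matrixP => i j; rewrite [RHS]mxE.
  apply/eqP; rewrite -sqrf_eq0 eq_le sqr_ge0 andbT -h0.
  exact: mxdot_sqr_coord_le.
by rewrite linearB /= hp sub0r oppr_gt0.
Qed.

(** * Proper cones and a compact base of the dual cone *)

Lemma mxdot_delta (R : comPzRingType) (m n : nat) (W : 'M[R]_(m, n)) i j :
  mxdot W (delta_mx i j) = W i j.
Proof.
rewrite /mxdot (bigD1 (i, j)) //= mxE !eqxx mulr1 big1 ?addr0 // => -[k l] /= h.
by rewrite mxE -pair_eqE /= in h *; rewrite (negbTE h) mulr0.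
Qed.

(** The sum is twice the midpoint, which convexity provides. *)
Lemma proper_coneD (R : realType) (n : nat) (C : set 'rV[R]_n) u v :
  proper_cone C -> C u -> C v -> C (u + v).
Proof.
move=> [_ _ cvxC [CZ _ _]] Cu Cv.
have h0 : 0 <= 2^-1 :> R by lra.
have h1 : 2^-1 <= 1 :> R by lra.
have := cvxC u v (Itv01 h0 h1); rewrite !inE => /(_ Cu Cv) h.
have := CZ 2 _ (ltW (ltr0n _ 2)) h.
rewrite /conv /= scalerDr !scalerA.
have -> : 2 * unstable.onem 2^-1 = 1 :> R by rewrite /unstable.onem; lra.
by rewrite divff // !scale1r.
Qed.

Lemma proper_cone0 (R : realType) (n : nat) (C : set 'rV[R]_n) :
  proper_cone C -> C 0.
Proof. by move=> [[c Cc] _ _ [CZ _ _]]; rewrite -(scale0r c); exact: CZ. Qed.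

Lemma proper_cone_interior (R : realType) (n : nat) (C : set 'rV[R]_n) :
  proper_cone C ->
  exists e, exists2 r : R, 0 < r & forall v, `|v| <= r -> C (e + v).
Proof.
move=> [_ _ _ [_ [e intCe] _]]; exists e.
have /nbhs_ballP[r r0 Cr] : nbhs e C by exact: intCe.
exists (r / 2) => [|v vr]; first by rewrite divr_gt0.
apply: Cr; rewrite -ball_normE /= opprD addNKr normrN.
by rewrite (le_lt_trans vr) // ltr_pdivrMr // ltr_pMr // ltr1n.
Qed.

(** A slice of the dual cone: when [e] is interior to [C], it is compact, and every nonzero
    functional of the dual cone is a positive multiple of one of its elements. *)
Definition dual_base {R : realType} {n : nat} (C : set 'rV[R]_n) (e : 'rV[R]_n) :
  set 'rV[R]_n := [set w | dual_cone C (mxdot w) /\ mxdot w e = 1].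

(** The functional is tested at [e - (r / |v|) v], a point of [C]; its value at [e] therefore
    controls its size. *)
Lemma dual_cone_le (R : realType) (n : nat) (C : set 'rV[R]_n) e (r : R) w v :
  (forall v, `|v| <= r -> C (e + v)) -> 0 < r -> dual_cone C (mxdot w) ->
  r * mxdot w v <= `|v| * mxdot w e.
Proof.
move=> Ce r0 Cw; have [->|v0] := eqVneq v 0.
  by rewrite linear0 normr0 mulr0 mul0r.
have nv : 0 < `|v| by rewrite normr_gt0.
have := Cw (e + - (r / `|v|) *: v).
rewrite linearD /= [mxdot w (_ *: v)]linearZ /= => /(_ _)/wrap[].
  apply: Ce; rewrite normrZ normrN ger0_norm ?divr_ge0 // ?(ltW r0) //.
  by rewrite divfK ?gt_eqF.
rewrite mulNr subr_ge0 mulrAC ler_pdivrMr // mulrC; lra.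
Qed.

(** Obtained at plus and minus a basis vector. It bounds the dual base, and it shows that a
    functional of the dual cone vanishing at [e] is zero. *)
Lemma dual_cone_coord_le (R : realType) (n : nat) (C : set 'rV[R]_n) e (r : R) w i j :
  (forall v, `|v| <= r -> C (e + v)) -> 0 < r -> dual_cone C (mxdot w) ->
  r * `|w i j| <= mxdot w e.
Proof.
move=> Ce r0 Cw.
have we : 0 <= mxdot w e.
  by rewrite -[e]addr0; apply: Cw; apply: Ce; rewrite normr0 ltW.
have h v : `|v| <= 1 -> r * mxdot w v <= mxdot w e.
  by move=> v1; apply: le_trans (dual_cone_le v Ce r0 Cw) _; rewrite ler_piMl.
have d1 : `|delta_mx i j : 'rV[R]_n| <= 1.
  apply: mx_norm_le => // k l; rewrite mxE.
  by case: (_ && _); rewrite ?normr1 ?normr0.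
have := h _ d1; have := h (- delta_mx i j); rewrite normrN => /(_ d1).
rewrite linearN /= mxdot_delta mulrN => h1 h2.
rewrite -[in r in r * _](gtr0_norm r0) -normrM ler_norml; lra.
Qed.

Lemma dual_base_compact (R : realType) (n : nat) (C : set 'rV[R]_n) e (r : R) :
  (forall v, `|v| <= r -> C (e + v)) -> 0 < r -> compact (dual_base C e).
Proof.
move=> Ce r0; apply: bounded_closed_compact.
  exists (r^-1); split; first exact: num_real.
  move=> M rM w [Cw we]; apply: le_trans (ltW rM).
  apply: mx_norm_le => [|i j]; first by rewrite invr_ge0 ltW.
  rewrite -[_^-1]mul1r ler_pdivlMr // mulrC -we.
  exact: dual_cone_coord_le Ce r0 Cw.
have cf c : continuous (fun w : 'rV[R]_n => mxdot w c).
  by apply: mxdot_continuous; [move=> w; exact: cvg_id|exact: cst_continuous].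
have -> : dual_base C e =
    (\bigcap_(c in C) [set w | 0 <= mxdot w c]) `&` [set w | mxdot w e = 1] by [].
apply: closedI.
  apply: closed_bigI => c _.
  by refine (preimage_closed (in1W (cf c)) (@closed_ge R 0)).
by refine (preimage_closed (in1W (cf e)) (@closed_eq R 1)).
Qed.

(** A bipolar theorem: a vector separating [x] from [C] is positive at [e], hence rescales to an
    element of the base that is negative at [x]. *)
Lemma dual_base_bipolar (R : realType) (n : nat) (C : set 'rV[R]_n) e (r : R) x :
  proper_cone C -> (forall v, `|v| <= r -> C (e + v)) -> 0 < r ->
  (forall w, dual_base C e w -> 0 <= mxdot w x) -> C x.
Proof.
move=> pC Ce r0 hx; apply: contrapT => Cx.
have [_ clC _ [CZ _ _]] := pC.
have [w Cw wx] := separation clC (proper_cone0 pC)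
  (fun u v => proper_coneD pC) CZ Cx.
have we : 0 < mxdot w e.
  rewrite lt_neqAle eq_sym; apply/andP; split; last first.
    by rewrite -[e]addr0; apply: Cw; apply: Ce; rewrite normr0 ltW.
  apply/eqP => we; suff w0 : w = 0 by move: wx; rewrite w0 mxdotC linear0 ltxx.
  apply/matrixP => i j; rewrite mxE; apply/normr0_eq0/eqP.
  rewrite eq_le normr_ge0 andbT -(pmulr_rle0 _ r0) -we.
  exact: dual_cone_coord_le Ce r0 Cw.
have := hx ((mxdot w e)^-1 *: w).
have wE c : mxdot ((mxdot w e)^-1 *: w) c = (mxdot w e)^-1 * mxdot w c.
  by rewrite mxdotC linearZ /= mxdotC.
rewrite wE pmulr_rge0 ?invr_gt0 // leNgt wx => hB.
suff /hB : dual_base C e ((mxdot w e)^-1 *: w) by [].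
split=> [c Cc|]; first by rewrite /= wE mulr_ge0 ?invr_ge0 ?(ltW we) // Cw.
by rewrite wE mulVf ?gt_eqF.
Qed.

(** If [y] were interior, [y - t *: e] would lie in [C] for some small [t > 0], yet [w] takes the
    value [- t] there. *)
Lemma dual_base_boundary (R : realType) (n : nat) (C : set 'rV[R]_n) e w y :
  C y -> dual_base C e w -> mxdot w y = 0 -> boundary C y.
Proof.
move=> Cy [Cw we] wy; split; first exact: subset_closure.
move=> /nbhs_ballP[r /= r0 Cr].
pose t := r / (`|e| + 1) / 2.
have e0 : 0 <= `|e| by [].
have t0 : 0 < t by rewrite /t !divr_gt0 //; lra.
have := Cw (y - t *: e); rewrite linearB /= [mxdot w (_ *: e)]linearZ /=.
rewrite wy we sub0r mulr1.
suff /[swap]/[apply] : C (y - t *: e) by lra.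
apply: Cr; rewrite -ball_normE /= opprB addrC subrK normrZ gtr0_norm //.
have : t * (`|e| + 1) * 2 = r by rewrite /t; field; lra.
nra.
Qed.

(** The constant is the minimum of [f] on the compact unit sphere of [C]; homogeneity does the
    rest. *)
Lemma proper_cone_coercive (R : realType) (n : nat) (C : set 'rV[R]_n)
    (f : {scalar 'rV[R]_n}) :
  proper_cone C -> (forall c, C c -> c != 0 -> 0 < f c) ->
  exists2 d : R, 0 < d & forall c, C c -> d * `|c| <= f c.
Proof.
move=> [_ clC _ [CZ _ _]] f0.
pose A := C `&` [set v | `|v| = 1].
have CA c : C c -> c != 0 -> A (`|c|^-1 *: c).
  move=> Cc c0; split; first by apply: CZ => //; rewrite invr_ge0.
  by rewrite /= normrZ normfV normr_id mulVf // normr_eq0.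
have cA : compact A.
  apply: bounded_closed_compact.
    exists 1; split; first exact: num_real.
    by move=> M M1 v [_ /= ->]; exact: ltW.
  apply: closedI => //.
  have cn : continuous (fun v : 'rV[R]_n => `|v|) by exact: norm_continuous.
  by refine (preimage_closed (in1W cn) (@closed_eq R 1)).
have cf : continuous (f : 'rV[R]_n -> R^o).
  by apply: linear_mx_continuous; exact: linearP.
(* An empty sphere means that [C] has only the zero vector, where any constant works. *)
have [A0|nA] := pselect (A !=set0); last first.
  exists 1 => // c Cc; have [->|c0] := eqVneq c 0; first by rewrite normr0 linear0 mulr0.
  by case: nA; exists (`|c|^-1 *: c); exact: CA.
have [p pA pmin] := EVT_min_rV A0 cA (continuous_subspaceT cf).
move: pA; rewrite inE => -[Cp p1].
have p0 : p != 0 by rewrite -normr_eq0 p1 oner_neq0.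
exists (f p) => [|c Cc]; first exact: f0.
have [->|c0] := eqVneq c 0; first by rewrite normr0 linear0 mulr0.
have := pmin (`|c|^-1 *: c); rewrite inE => /(_ (CA _ Cc c0)).
by rewrite linearZ /= mulrC ler_pdivlMr ?normr_gt0.
Qed.

(** * Derivatives of vector-valued functions and exponential decay *)

Lemma is_derive_cvgP (R : realFieldType) (V W : normedModType R) (f : V -> W)
    (a v : V) (df : W) :
  is_derive a v f df <->
  h^-1 *: (f (h *: v + a) - f a) @[h --> 0^'] --> df.
Proof.
split=> [[fd <-]|fd]; first by refine fd.
by apply: DeriveDef; [by apply/cvg_ex; exists df|by apply: (cvg_lim _ fd)].
Qed.

Lemma cvg_mx (R : realFieldType) (m n : nat) (T : Type) (F : set_system T)
    (f : T -> 'M[R]_(m, n)) (l : 'M[R]_(m, n)) :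
  Filter F -> (forall i j, f x i j @[x --> F] --> l i j) -> f @ F --> l.
Proof.
move=> FF fl; apply/cvgrPdist_le => /= e e0; near=> x.
apply: mx_norm_le; first exact: ltW.
move=> i j; rewrite !mxE; move: i j; near: x.
apply: filter_forall => i; apply: filter_forall => j.
exact: ((cvgrPdist_le _ _).1 (fl i j)).
Unshelve. all: by end_near. Qed.

Lemma is_derive_linear (R : realFieldType) (V : normedModType R) (m n : nat)
    (W : normedModType R) (f : 'M[R]_(m, n) -> W) (X : V -> 'M[R]_(m, n)) a v dX :
  linear f -> is_derive a v X dX -> is_derive a v (f \o X) (f dX).
Proof.
move=> lf /is_derive_cvgP dXa; apply/is_derive_cvgP.
pose f' : {linear 'M[R]_(m, n) -> W} := HB.pack f (GRing.isLinear.Build _ _ _ _ f lf).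
have := cvg_comp _ f dXa (linear_mx_continuous lf (x:=dX)).
rewrite [X in X @ _ --> _ -> _](_ : _ =
  fun h : R => h^-1 *: (f (X (h *: v + a)) - f (X a))) //.
by apply/funext => h /=; rewrite -[f]/(f' : _ -> _) linearZ linearB.
Qed.

Lemma is_derive_mx (R : realFieldType) (V : normedModType R) (m n : nat)
    (X : V -> 'M[R]_(m, n)) a v (dX : 'M[R]_(m, n)) :
  (forall i j, is_derive a v (fun x => X x i j) (dX i j)) -> is_derive a v X dX.
Proof.
move=> h; apply/is_derive_cvgP; apply: cvg_mx => i j.
have /is_derive_cvgP := h i j.
by apply: cvg_trans; apply: near_eq_cvg; near=> x; rewrite !mxE.
Unshelve. all: by end_near. Qed.

(** Difference quotients from the left are nonpositive. Only earlier times are compared, since the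
    minimum may be attained at the right end of a time interval. *)
Lemma derive_at_left_min (R : realFieldType) (h : R -> R) (t d : R) :
  0 < t -> is_derive t 1 h d -> (forall s, 0 <= s <= t -> h t <= h s) -> d <= 0.
Proof.
move=> t0 [hd <-] hmin.
have -> : 'D_1 h t = lim (u^-1 *: ((h \o shift t) (u *: 1) - h t) @[u --> 0^'-]).
  exact: cvg_at_leftE.
apply: limr_le.
  apply/cvg_ex; exists ('D_1 h t); apply: cvg_trans hd; apply: cvg_app.
  move=> A [e egt0 Ae]; exists e => // x xe xgt0; apply: Ae => //.
  exact/ltr0_neq0.
near=> u; apply: mulr_le0_ge0.
  by rewrite invr_le0; apply: ltW; near: u; exists 1 => /=.
rewrite subr_ge0 [_%:A]mulr1; apply: hmin; near: u.
exists t => // u /=; rewrite sub0r normrN => ut u0.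
move: ut; rewrite ltr0_norm //; lra.
Unshelve. all: by end_near. Qed.

(** Gronwall: the derivative of [expR (k * t) * g t] is nonpositive. *)
Lemma exp_decay (R : realType) (g dg : R -> R) (k : R) :
  {within `[0, +oo[, continuous g} ->
  (forall t : R, 0 < t -> is_derive t 1 g (dg t)) ->
  (forall t : R, 0 < t -> dg t <= - k * g t) ->
  forall t, 0 <= t -> g t <= expR (- (k * t)) * g 0.
Proof.
move=> cg gd gk t t0.
pose h : R -> R := (fun t => expR (k * t)) * g.
have hd (s : R) : 0 < s -> is_derive s 1 h (expR (k * s) * (dg s + k * g s)).
  move=> s0.
  have e1 : is_derive s 1 (fun t : R => k * t) (k * 1).
    by have := is_deriveZ k (is_derive_id s 1).
  have e2 : is_derive s 1 (expR \o (fun t : R => k * t)) (expR (k * s) * (k * 1)).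
    exact: is_derive1_comp.
  have := is_deriveM e2 (gd _ s0); rewrite /h => e3.
  apply: is_derive_eq e3 _; rewrite /GRing.scale /=; ring.
have : h t <= h 0.
  apply: (@ler0_derive1_nincry _ h 0) => //.
  - by move=> s; rewrite in_itv /= andbT => /hd [].
  - move=> s; rewrite in_itv /= andbT => s0; rewrite derive1E.
    have [_ ->] := hd _ s0; rewrite pmulr_rle0 ?expR_gt0 //.
    by have := gk _ s0; lra.
  move=> s; apply: continuousM; last exact: cg.
  apply: continuous_subspaceT => u.
  apply: (@continuous_comp _ _ _ ( *%R k) expR); last exact: continuous_expR.
  exact: mulrl_continuous.
rewrite /h !fctE mulr0 expR0 mul1r => ht.
by rewrite expRN mulrC ler_pdivlMr ?expR_gt0 // mulrC.
Qed.

(** * Existence of solutions of a linear system by the exponential series *)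

(** Comparison with the exponential series of [a * |t|]. *)
Lemma is_cvg_pseries_fact (R : realType) (u : R^nat) (a b t : R) :
  0 <= a -> (forall k, `|u k| <= a ^+ k * b) ->
  cvgn (pseries (fun k => u k / k`!%:R) t).
Proof.
move=> a0 ub.
have b0 : 0 <= b by have := le_trans (normr_ge0 _) (ub 0); rewrite expr0 mul1r.
apply: normed_cvg => /=.
apply: (@series_le_cvg _ _ (fun k => b * ((a * `|t|) ^+ k / k`!%:R))) => //.
- by move=> k /=.
- by move=> k; rewrite mulr_ge0 // divr_ge0 // exprn_ge0 // mulr_ge0.
- move=> k /=; rewrite !normrM normfV normrX (ger0_norm (ler0n _ _)).
  rewrite exprMn.
  rewrite [leRHS](_ : _ = a ^+ k * b / k`!%:R * `|t| ^+ k); last by ring.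
  by rewrite !ler_wpM2r ?invr_ge0 ?exprn_ge0.
have h := is_cvg_series_exp_coeff (a * `|t|).
have := is_cvg_seriesZ (k := b) h.
by rewrite (_ : b *: _ = fun k => b * ((a * `|t|) ^+ k / k`!%:R)).

Qed.

(** Differentiating a series in [t ^ k / k!] shifts its coefficients by one. *)
Lemma pseries_diffs_fact (R : realType) (u : R^nat) :
  pseries_diffs (fun k => u k / k`!%:R) = (fun k => u k.+1 / k`!%:R).
Proof.
apply/funext => k.
by rewrite /pseries_diffs factS natrM invfM mulrCA mulVKf // pnatr_eq0.
Qed.

(** The solution is [exp (t L) X0], built entry by entry as a power series whose coefficients are
    the entries of [L^k X0 / k!]. *)
Lemma linear_solution_exists (R : realType) (m n : nat)
    (L : 'M[R]_(m, n) -> 'M[R]_(m, n)) (X0 : 'M[R]_(m, n)) :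
  linear L -> exists X, solution L X /\ X 0 = X0.
Proof.
move=> lL.
pose L' : {linear 'M[R]_(m, n) -> 'M[R]_(m, n)} :=
  HB.pack L (GRing.isLinear.Build _ _ _ _ L lL).
have cL : continuous L by exact: linear_mx_continuous.
have [a /ltW a0 La] := linear_mx_bounded lL.
have iterL k : `|iter k L X0| <= a ^+ k * `|X0|.
  elim: k => [|k IHk] /=; first by rewrite mul1r.
  by rewrite (le_trans (La _)) // exprS -mulrA ler_wpM2l.
pose c i j k := iter k L X0 i j.
have cle i j s k : `|c i j (k + s)%N| <= a ^+ k * (a ^+ s * `|X0|).
  by rewrite mulrA -exprD (le_trans (ler_mx_norm _ _ _)).
have cc i j s t : cvgn (pseries (fun k => c i j (k + s)%N / k`!%:R) t).
  by apply: is_cvg_pseries_fact a0 _ => k; exact: cle.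
(* [X s] sums the iterates shifted by [s], so [X 1] is both the image of [X 0] under [L] and its
   termwise derivative. *)
pose X (s : nat) (t : R) : 'M[R]_(m, n) :=
  \matrix_(i, j) limn (pseries (fun k => c i j (k + s)%N / k`!%:R) t).
have XE s (t : R) :
    (\sum_(0 <= k < N) (t ^+ k / k`!%:R) *: iter (k + s) L X0) @[N --> \oo] -->
    X s t.
  apply: cvg_mx => i j; rewrite mxE.
  have := cc i j s t; rewrite /pseries /series /=.
  apply: cvg_trans; apply: near_eq_cvg; near=> N.
  by rewrite summxE; apply: eq_bigr => k _; rewrite mxE mulrAC [RHS]mulrC mulrA.
have LX t : L (X 0 t) = X 1 t.
  have /(cvg_lim (@norm_hausdorff _ _)) <- := XE 1 t.
  apply/esym/(cvg_lim (@norm_hausdorff _ _)).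
  have := cvg_comp _ L (XE 0 t) (cL (X 0 t)).
  apply: cvg_trans; apply: near_eq_cvg; near=> N.
  rewrite /= -[L]/(L' : _ -> _) linear_sum; apply: eq_bigr => k _.
  by rewrite linearZ addn0 addn1.
have Xd (t : R) : is_derive t 1 (X 0) (L (X 0 t)).
  rewrite LX; apply: is_derive_mx => i j.
  have -> : (fun t : R => X 0 t i j) =
      (fun t => limn (pseries (fun k => c i j (k + 0)%N / k`!%:R) t)).
    by apply/funext => u; rewrite mxE.
  have cE s : pseries_diffs (fun k => c i j (k + s)%N / k`!%:R) =
      (fun k => c i j (k + s.+1)%N / k`!%:R).
    rewrite (pseries_diffs_fact (fun k => c i j (k + s)%N)).
    by apply/funext => k; rewrite addSnnS.
  rewrite mxE -cE; apply: (@pseries_snd_diffs _ _ (`|t| + 1)); rewrite ?cE //.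
  by rewrite ltr_normr ltrDl ltr01.
exists (X 0); split; first split.
- apply: continuous_subspaceT => t; apply: differentiable_continuous.
  by apply/derivable1_diffP; have [] := Xd t.
- by move=> t _.
(* At time 0 only the term [k = 0] survives, with [0 ^ 0 = 1]; the shift discards the empty partial
   sum. *)
have /(cvg_lim (@norm_hausdorff _ _)) <- := XE 0 0.
apply: (cvg_lim (@norm_hausdorff _ _)); rewrite -cvg_shiftS /=.
apply: cvg_near_cst; near=> N.
rewrite big_nat_recl //= big1 => [|k _]; last by rewrite expr0n mul0r scale0r.
by rewrite addr0 expr0 divr1 scale1r.
Unshelve. all: by end_near. Qed.

(** * The coupled field and forward invariance of the product cone *)

Lemma coupled_field_linear (R : realType) (n m : nat)
    (A : 'I_m -> {linear 'rV[R]_n -> 'rV[R]_n})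
    (D : 'I_m -> 'I_m -> {linear 'rV[R]_n -> 'rV[R]_n}) :
  linear (coupled_field A D).
Proof.
move=> a X Y; apply/row_matrixP => i.
rewrite [RHS]linearP /= !rowK [row i (_ + _)]linearP [A i _]linearP /=.
rewrite scalerDr addrACA; congr (_ + _).
rewrite scaler_sumr -big_split; apply: eq_bigr => j _ /=.
by rewrite [row j (_ + _)]linearP /= opprD addrACA -scalerBr linearP.
Qed.

(** The remaining coupling terms [f (D i j x_j)] are nonnegative because [D i j] preserves [C]. A
    functional on one block suffices, as the minimum in the invariance argument singles out one
    block. *)
Lemma coupled_field_quasi_monotone (R : realType) (n m : nat) (C : set 'rV[R]_n)
    (A : 'I_m -> {linear 'rV[R]_n -> 'rV[R]_n})
    (D : 'I_m -> 'I_m -> {linear 'rV[R]_n -> 'rV[R]_n})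
    (X : 'M[R]_(m, n)) (i : 'I_m) (f : {scalar 'rV[R]_n}) :
  (forall i, quasi_monotone C (A i)) -> diffusive_family C D ->
  (forall j, C (row j X)) -> dual_cone C f -> boundary C (row i X) ->
  f (row i X) = 0 -> 0 <= f (row i (coupled_field A D X)).
Proof.
move=> qmA difD CX Cf bX fX; rewrite rowK linearD addr_ge0 //; first exact: qmA.
rewrite linear_sum; apply: sumr_ge0 => j ji; rewrite eq_sym in ji.
have [_ DC D0] := difD _ _ ji.
by rewrite linearB /= linearB /= (D0 _ _ bX Cf fX) subr0; apply: Cf; exact: DC.
Qed.

(** Freezing [X] at its initial value for negative times gives continuity on the whole line, from
    which joint continuity in time and functional follows. *)
Lemma continuous_max0 (R : realType) (V : topologicalType) (X : R -> V) :
  {within `[0, +oo[, continuous X} -> continuous (fun t : R => X (Num.max t 0)).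
Proof.
move=> cX t.
have m0 (s : R) : `[0, +oo[%classic (Num.max s 0).
  by rewrite /= in_itv /= andbT le_max lexx orbT.
have cXt : X s @[s --> within `[0, +oo[ (nbhs (Num.max t 0))] --> X (Num.max t 0).
  by rewrite (nbhs_subspace_in (m0 t)); exact: cX.
have cm : {for t, continuous (fun s : R => Num.max s 0)}.
  have cid0 : {for t, continuous (idfun : R -> R)} by exact: cvg_id.
  by refine (@continuous_max R R idfun (cst 0) t cid0 (cst_continuous (x0 := t))).
move=> P HP; have cP : nbhs t (fun s : R =>
    `[0, +oo[%classic (Num.max s 0) -> P (X (Num.max s 0))).
  by have := cm _ (cXt _ HP).
by refine (filterS _ cP) => s /(_ (m0 s)).
Qed.

(* The minimum over time, block and normalized dual functional of the functionals
   applied to the blocks, discounted by [exp (- M t)], cannot be negative: at a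
   negative minimum, adding the corresponding multiple of [e] to every block gives a
   point where quasi-monotonicity applies and forces the derivative to be positive. *)
Lemma coupled_field_invariant (R : realType) (n m : nat) (C : set 'rV[R]_n)
    (A : 'I_m -> {linear 'rV[R]_n -> 'rV[R]_n})
    (D : 'I_m -> 'I_m -> {linear 'rV[R]_n -> 'rV[R]_n}) (X : R -> 'M[R]_(m, n)) :
  proper_cone C -> (forall i, quasi_monotone C (A i)) -> diffusive_family C D ->
  solution (coupled_field A D) X -> (forall i, C (row i (X 0))) ->
  forall t : R, 0 <= t -> forall i, C (row i (X t)).
Proof.
move=> pC qmA difD [cX dX] X0 T T0 i0.
have [e [r r0 Ce]] := proper_cone_interior pC.
apply: (dual_base_bipolar pC Ce r0) => w0 Bw0.
set L := coupled_field A D in dX *.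
pose E : 'M[R]_(m, n) := \matrix_(i < m) e.
(* [M] strictly exceeds every normalised functional on the blocks of [L E]; discounting at this rate
   makes the derivative at a negative minimum strictly positive. *)
pose M := `|L E| / r + 1.
have LM i w : dual_base C e w -> mxdot w (row i (L E)) < M.
  move=> [Cw we]; have := dual_cone_le (row i (L E)) Ce r0 Cw.
  rewrite we mulr1 mulrC -ler_pdivlMr // => h.
  rewrite (le_lt_trans h) // ltr_pwDr // ler_pM2r ?invr_gt0 //.
  by apply: mx_norm_le => // k l; rewrite mxE ler_mx_norm.
pose Y t := X (Num.max t 0).
have YE t : 0 <= t -> Y t = X t by move=> t0; rewrite /Y max_l.
have cY : continuous Y by exact: continuous_max0.
pose h i (p : R * 'rV[R]_n) := expR (- (M * p.1)) * mxdot p.2 (row i (Y p.1)).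
have ch i : continuous (h i).
  move=> p; apply: cvgM.
    apply: (@continuous_comp _ _ _ (fun p : R * 'rV[R]_n => - (M * p.1)) expR).
      by apply: cvgN; apply: cvgM; [exact: cvg_cst|exact: cvg_fst].
    exact: continuous_expR.
  move: p; apply: mxdot_continuous => p; first exact: cvg_snd.
  apply: (@continuous_comp _ _ _ (fun p : R * 'rV[R]_n => Y p.1) (row i)).
    by apply: continuous_comp; [exact: cvg_fst|exact: cY].
  apply: linear_mx_continuous; exact: linearP.
pose K := `[0, T]%classic `*` dual_base C e.
have cK : compact K.
  by apply: compact_setX; [exact: segment_compact|exact: dual_base_compact Ce r0].
have K0 : K !=set0 by exists (T, w0); split => //=; rewrite in_itv /= T0 lexx.
have hm i : exists p, K p /\ forall q, K q -> h i p <= h i q.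
  have [p] := compact_EVT_min K0 cK (continuous_subspaceT (ch i)).
  by rewrite inE => Kp pmin; exists p; split => // q Kq; apply: pmin; rewrite inE.
have [p hp] := choice hm.
rewrite leNgt; apply/negP => neg.
have [i _ imin] := @arg_minP _ _ _ i0 xpredT (fun i => h i (p i)) isT.
have {imin} hmin j q : K q -> h i (p i) <= h j q.
  by move=> Kq; apply: le_trans (imin j isT) _; exact: (hp j).2.
have [] := hp i; case: (p i) hmin => t w /= hmin [/=].
rewrite in_itv /= => /andP[t0 tT] Bw _.
have {}neg : h i (t, w) < 0.
  apply: le_lt_trans (hmin i0 (T, w0) _) _.
    by split => //=; rewrite in_itv /= T0 lexx.
  by rewrite /h /= YE // pmulr_rlt0 ?expR_gt0.
(* At time 0 all blocks are in [C], so the negative minimum is attained later, where [X] is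
   differentiable. *)
have {}t0 : 0 < t.
  rewrite lt_neqAle t0 andbT; apply/eqP => t00; move: neg.
  rewrite -t00 /h /= YE // pmulr_rlt0 ?expR_gt0 // ltNge => /negP; apply.
  by apply: Bw.1; exact: X0.
pose a := expR (- (M * t)); have a0 : 0 < a by exact: expR_gt0.
(* [s] is the multiple of [e] that brings block [i] exactly to the zero set of [w]; minimality over
   blocks and functionals at time [t] puts all shifted blocks in [C]. *)
pose s := - mxdot w (row i (X t)).
have s0 : 0 < s.
  by move: neg; rewrite /h /= YE ?(ltW t0) // pmulr_rlt0 ?expR_gt0 // oppr_gt0.
have rowE j : row j (X t + s *: E) = row j (X t) + s *: e.
  by rewrite linearD linearZ /= rowK.
have CZ j : C (row j (X t + s *: E)).
  rewrite rowE; apply: (dual_base_bipolar pC Ce r0) => v Bv.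
  rewrite linearD linearZ /= Bv.2 mulr1 -(pmulr_rge0 _ a0) mulrDr mulrN.
  rewrite subr_ge0; have := hmin j (t, v); rewrite /h /= YE ?(ltW t0) //; apply.
  by split => //=; rewrite in_itv /= tT ltW.
have wZ : mxdot w (row i (X t + s *: E)) = 0.
  by rewrite rowE linearD linearZ /= Bw.2 mulr1 subrr.
have := coupled_field_quasi_monotone qmA difD CZ Bw.1
  (dual_base_boundary (CZ i) Bw wZ) wZ.
have lL := coupled_field_linear A D.
have -> : coupled_field A D (X t + s *: E) = L (X t) + s *: L E.
  by rewrite addrC lL addrC.
have -> : row i (L (X t) + s *: L E) = row i (L (X t)) + s *: row i (L E).
  by rewrite linearD linearZ.
rewrite linearD /= [mxdot w (_ *: _)]linearZ /=.
have lw : linear (fun Z : 'M[R]_(m, n) => mxdot w (row i Z) : R).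
  by move=> b Z1 Z2; rewrite linearP linearP.
have hd : is_derive t 1 (fun u : R => expR (- (M * u)) * mxdot w (row i (X u)))
    (a * (mxdot w (row i (L (X t))) - M * mxdot w (row i (X t)))).
  have e1 : is_derive t 1 (fun u : R => - (M * u)) (- (M * 1)).
    by have := is_deriveN (is_deriveZ M (is_derive_id t 1)).
  have e2 : is_derive t 1 (expR \o (fun u : R => - (M * u))) (a * - (M * 1)).
    exact: is_derive1_comp.
  have e3 := is_derive_linear lw (dX t t0).
  have e4 := is_deriveM e2 e3.
  by apply: is_derive_eq e4 _; rewrite /GRing.scale /= -/a; ring.
have := derive_at_left_min t0 hd.
move=> /(_ _)/wrap[].
  move=> u /andP[u0 ut]; have := hmin i (u, w); rewrite /h /= !YE ?(ltW t0) //; apply.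
  by split => //=; rewrite in_itv /= u0 (le_trans ut).
(* Quasi-monotonicity bounds [mxdot w (row i (L (X t)))] below by [- s * mxdot w (row i (L E))],
   which exceeds [- s * M]; so the derivative at [t] would be positive. *)
have := LM i w Bw; rewrite pmulr_rle0 //.
have -> : mxdot w (row i (X t)) = - s by rewrite opprK.
nra.
Qed.

(** * Exponential decay of all solutions and asymptotic stability *)

Lemma solution_lincomb (R : realType) (V : normedModType R) (f : V -> V) X Y (a b : R) :
  linear f -> solution f X -> solution f Y ->
  solution f (fun t => a *: X t + b *: Y t).
Proof.
move=> lf [cX dX] [cY dY]; split=> [t|t t0].
  have hX := cvgZl_tmp (k := a) (cX t).
  have hY := cvgZl_tmp (k := b) (cY t).
  exact: cvgD (hX _) (hY _).
have fE : f (a *: X t + b *: Y t) = a *: f (X t) + b *: f (Y t).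
  have f0 : f 0 = 0 by have := lf (-1) 0 0; rewrite !scaleN1r oppr0 addr0 addNr.
  by rewrite lf; congr (_ + _); have := lf b (Y t) 0; rewrite addr0 f0 addr0.
rewrite fE.
by have := is_deriveD (is_deriveZ a (dX t t0)) (is_deriveZ b (dY t t0)).
Qed.

Lemma proper_cone_scale_ball (R : realType) (n : nat) (C : set 'rV[R]_n) e (r s : R) v :
  proper_cone C -> (forall v, `|v| <= r -> C (e + v)) ->
  0 <= s -> `|v| <= s * r -> C (s *: e + v).
Proof.
move=> pC Ce; rewrite le0r => /predU1P[->|s0 vs].
  by rewrite mul0r normr_le0 => /eqP ->; rewrite scale0r addr0; exact: proper_cone0.
have [_ _ _ [CZ _ _]] := pC.
have -> : s *: e + v = s *: (e + s^-1 *: v).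
  by rewrite scalerDr scalerA divff ?gt_eqF // scale1r.
apply: CZ (ltW s0) _; apply: Ce.
by rewrite normrZ gtr0_norm ?invr_gt0 // mulrC ler_pdivrMr // mulrC.
Qed.

(** Each [- f (A i c)] dominates a multiple of [|c|], and [|c|] dominates a multiple of [f c];
    finitely many indices allow a common rate. *)
Lemma scalar_coercive_family (R : realType) (n m : nat) (C : set 'rV[R]_n)
    (A : 'I_m -> {linear 'rV[R]_n -> 'rV[R]_n}) (f : {scalar 'rV[R]_n}) :
  proper_cone C -> (forall c, C c -> c != 0 -> forall i, f (A i c) < 0) ->
  exists2 k : R, 0 < k & forall i c, C c -> f (A i c) <= - k * f c.
Proof.
move=> pC fA.
have lf : linear (f : 'rV[R]_n -> R^o) by exact: linearP.
have [k k0 fk] := linear_mx_bounded lf.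
have hd i : exists d : R, 0 < d /\ forall c, C c -> f (A i c) <= - d * `|c|.
  have lg : scalar (fun c => - f (A i c)).
    by move=> a u v; rewrite linearP linearP opprD mulrN.
  pose g : {scalar 'rV[R]_n} :=
    HB.pack (fun c => - f (A i c)) (GRing.isLinear.Build _ _ _ _ _ lg).
  have [|d d0 gd] := proper_cone_coercive (f := g) pC.
    by move=> c Cc c0; rewrite /= oppr_gt0; exact: fA.
  by exists d; split=> // c Cc; rewrite mulNr lerNr; exact: gd.
have [d dP] := choice hd.
(* The default 1 keeps [q] positive when [m = 0]. *)
pose q := \big[Num.min/1]_i d i.
have q0 : 0 < q by apply: lt_bigmin => // i _; exact: (dP i).1.
exists (q / k) => [|i c Cc]; first exact: divr_gt0.
apply: le_trans ((dP i).2 c Cc) _; rewrite !mulNr lerN2.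
apply: (@le_trans _ _ (q * `|c|)); last by apply: ler_wpM2r => //; exact: bigmin_le.
rewrite -mulrA ler_pM2l // mulrC ler_pdivrMr // mulrC.
by apply: le_trans (fk c); exact: ler_norm.
Qed.

(* The coupling terms cancel in pairs because [D i j = D j i]. *)
Lemma coupled_field_lyapunov (R : realType) (n m : nat) (C : set 'rV[R]_n)
    (A : 'I_m -> {linear 'rV[R]_n -> 'rV[R]_n})
    (D : 'I_m -> 'I_m -> {linear 'rV[R]_n -> 'rV[R]_n})
    (f : {scalar 'rV[R]_n}) (X : 'M[R]_(m, n)) :
  diffusive_family C D ->
  \sum_i f (row i (coupled_field A D X)) = \sum_i f (A i (row i X)).
Proof.
move=> difD.
pose F i j := f (D i j (row j X)) - f (D i j (row i X)).
have S0 : \sum_(i < m) \sum_(j < m | j != i) F i j = 0.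
  set S := LHS; suff : S = - S by lra.
  rewrite {1}/S (exchange_big_dep predT) //= /S -sumrN; apply: eq_bigr => i _.
  rewrite -sumrN; apply: eq_big => [j|j ij]; first by rewrite eq_sym.
  by have [DE _ _] := difD _ _ ij; rewrite /F !DE opprB.
rewrite -[RHS]addr0 -[X in _ = _ + X]S0 -big_split; apply: eq_bigr => i _ /=.
rewrite rowK linearD linear_sum; congr (_ + _); apply: eq_bigr => j _.
by rewrite !linearB.
Qed.

(** The constants [k] and [G] are uniform over all solutions, so that a single bound yields both
    stability and attractivity. *)
Lemma coupled_field_exp_stable (R : realType) (n m : nat) (C : set 'rV[R]_n)
    (A : 'I_m -> {linear 'rV[R]_n -> 'rV[R]_n})
    (D : 'I_m -> 'I_m -> {linear 'rV[R]_n -> 'rV[R]_n}) :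
  proper_cone C -> (forall i, quasi_monotone C (A i)) ->
  (exists f : {scalar 'rV[R]_n}, common_linear_lyapunov C A f) ->
  diffusive_family C D ->
  exists2 k : R, 0 < k & exists2 G : R, 0 <= G &
    forall X, solution (coupled_field A D) X ->
    forall t : R, 0 <= t -> `|X t| <= G * `|X 0| * expR (- (k * t)).
Proof.
move=> pC qmA [f [Cf f0 fA]] difD.
set L := coupled_field A D.
have lL : linear L := coupled_field_linear A D.
have [e [r r0 Ce]] := proper_cone_interior pC.
have [d d0 fd] := proper_cone_coercive pC f0.
have [k k0 fk] := scalar_coercive_family pC fA.
pose E : 'M[R]_(m, n) := \matrix_(i < m) e.
pose V (Z : 'M[R]_(m, n)) := \sum_(i < m) f (row i Z) : R.
have lV : linear (V : _ -> R^o).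
  move=> a Y Z; rewrite /V scaler_sumr -big_split; apply: eq_bigr => i _.
  by rewrite linearP linearP.
pose V' : {linear 'M[R]_(m, n) -> R^o} :=
  HB.pack (V : _ -> R^o) (GRing.isLinear.Build _ _ _ _ _ lV).
pose K := [set Z : 'M[R]_(m, n) | forall i, C (row i Z)].
have V_ge0 Z : K Z -> 0 <= V Z by move=> KZ; apply: sumr_ge0 => i _; exact: Cf.
(* Each block is controlled by its own term of [V], the other terms being nonnegative. *)
have normV Z : K Z -> `|Z| <= V Z / d.
  move=> KZ; apply: mx_norm_le => [|i j].
    by rewrite divr_ge0 ?V_ge0 // ltW.
  rewrite ler_pdivlMr // mulrC.
  have : `|row i Z 0 j| <= `|row i Z| by exact: ler_mx_norm.
  rewrite mxE -(ler_pM2l d0) => /le_trans; apply; apply: (le_trans (fd _ (KZ i))).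
  by rewrite /V (bigD1 i) //= lerDl; apply: sumr_ge0 => l _; exact: Cf.
have invK := coupled_field_invariant pC qmA difD.
have [U [sU U0]] := linear_solution_exists E lL.
have KU (t : R) : 0 <= t -> K (U t).
  apply: invK sU _ _ => i; rewrite U0 rowK -[e]addr0; apply: Ce.
  by rewrite normr0 ltW.
have VU (t : R) : 0 <= t -> V (U t) <= expR (- (k * t)) * V E.
  rewrite -U0; apply: (@exp_decay _ (V \o U) (fun t => V (L (U t)))) => //.
  - have [cU _] := sU; move=> s.
    exact: (continuous_comp (cU s) (linear_mx_continuous lV (x := U s))).
  - by move=> s s0; exact: is_derive_linear lV (sU.2 s s0).
  move=> s s0; rewrite /V (coupled_field_lyapunov A f _ difD) mulr_sumr.
  by apply: ler_sum => i _; apply: fk; exact: KU (ltW s0) i.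
have VE0 : 0 <= V E by rewrite -U0; apply: V_ge0; exact: KU.
(* Of the factor 3, two come from [V (s U + X) <= 2 s V U] and one from removing [s U] again;
   [1 / d] comes from [normV] and [1 / r] from [s]. *)
exists k => //; exists (3 * V E / d / r); first by rewrite !divr_ge0 ?mulr_ge0 // ltW.
move=> X sX t t0.
(* With [s * r = |X 0|], every block of [s E + X 0] and of [s E - X 0] lies in [C]. *)
pose s := `|X 0| / r; have s0 : 0 <= s by rewrite divr_ge0 // ltW.
have KX (b : R) : `|b| = 1 -> K (s *: U t + b *: X t).
  move=> b1; refine (invK _ (solution_lincomb s b lL sU sX) _ t t0) => i.
  rewrite linearD /= U0 linearZ /= rowK.
  apply: proper_cone_scale_ball pC Ce s0 _; rewrite divfK ?gt_eqF //.
  apply: mx_norm_le => // l j; rewrite !mxE normrM b1 mul1r; exact: ler_mx_norm.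
have K1 := KX 1 (normr1 R); have K2 := KX (-1) (normrN1 R).
(* Both summands are nonnegative, so each one is at most [2 * s * V (U t)]. *)
have VP : V (s *: U t + 1 *: X t) + V (s *: U t + -1 *: X t) = 2 * s * V (U t).
  rewrite -[V]/(V' : _ -> _) -linearD scaleN1r scale1r addrACA subrr addr0 -scalerDl.
  by rewrite linearZ mulr_natl mulr2n.
have XE : X t = (s *: U t + 1 *: X t) - s *: U t by rewrite scale1r addrC addKr.
rewrite XE; apply: le_trans (ler_normB _ _) _.
rewrite normrZ (ger0_norm s0).
have h1 := normV _ K1; have h2 := V_ge0 _ K2; have h3 := normV _ (KU t t0).
have h4 := VU t t0.
apply: (@le_trans _ _ (3 * s * V (U t) / d)).
  rewrite ler_pdivlMr // in h1; rewrite ler_pdivlMr // in h3; rewrite ler_pdivlMr //.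
  nra.
rewrite [leRHS](_ : _ = 3 * s * (expR (- (k * t)) * V E) / d); last by rewrite /s; ring.
by rewrite ler_pM2r ?invr_gt0 // ler_wpM2l // mulr_ge0.
Qed.

Theorem theorem8 (R : realType) (n m : nat) (C : set 'rV[R]_n)
  (A : 'I_m -> {linear 'rV[R]_n -> 'rV[R]_n}) :
  proper_cone C ->
  (forall i, quasi_monotone C (A i)) ->
  (exists lambda : {scalar 'rV[R]_n}, common_linear_lyapunov C A lambda) ->
  forall D : 'I_m -> 'I_m -> {linear 'rV[R]_n -> 'rV[R]_n},
    diffusive_family C D ->
    asymptotically_stable (coupled_field A D) (0 : 'M[R]_(m, n)) setT.
Proof.
move=> pC qmA exL D difD.
have [k k0 [G G0 hG]] := coupled_field_exp_stable pC qmA exL difD.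
have lL := coupled_field_linear A D.
split.
- by have := lL (-1) 0 0; rewrite !scaleN1r oppr0 addr0 addNr.
- by move=> X0 _; exact: linear_solution_exists.
(* Dividing by [G + 1] rather than [G] keeps the radius positive when [G = 0]. *)
- move=> eps eps0; exists (eps / (G + 1)) => [|X sX _].
    by rewrite divr_gt0 // ltr_wpDl.
  rewrite !subr0 ltr_pdivlMr ?ltr_wpDl // => X0 t t0; rewrite subr0.
  apply: le_lt_trans (hG X sX t t0) _; apply: le_lt_trans X0.
  have : expR (- (k * t)) <= 1 by rewrite -expR0 ler_expR oppr_le0 mulr_ge0 // ltW.
  have := expR_gt0 (- (k * t)); have := normr_ge0 (X 0).
  set x := `|X 0|; set y := expR _ => x0 y0 y1.
  have : G * x * y <= G * x by rewrite ler_piMr // mulr_ge0.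
  lra.
move=> X sX _; apply: norm_cvg0.
apply: (@squeeze_cvgr _ _ _ _ (cst 0) (fun t => G * `|X 0| * expR (- (k * t)))).
- near=> t; rewrite normr_ge0 /=; exact: hG.
- exact: cvg_cst.
rewrite -[X in _ --> X](mulr0 (G * `|X 0|)); apply: cvgM; first exact: cvg_cst.
apply: (cvg_comp (fun t : R => k * t) (fun u => expR (- u))); last exact: cvgr_expR.
exact: gt0_cvgMry.
Unshelve. all: by end_near. Qed.
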